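(* Let $n\ge1$. Let $x_1,\dots,x_n$ be nonzero complex numbers with $x_i/x_j\notin\{q^m:m\in\mathbb{Z}\}$ for $i\ne j$. Let $b,z,w,r,s,t\in\mathbb{C}$ and $u,v,bz\in\mathbb{C}\setminus\{q^{-m}:m\ge0\}$. Assume $\max(|z|,|w|)<1$ and, for each $j=1,\dots,n$, $$\max(|z|,|w|)<|x_1x_2\cdots x_n|\,|x_j|^{-n}q^{(n-1)/2}.$$ For $\mathbf m=(m_1,\dots,m_n)\in\mathbb{Z}_{\ge0}^n$ put $|\mathbf m|=m_1+\cdots+m_n$ and $e_2(\mathbf m)=\sum_{1\le i<j\le n}m_im_j$, and define $$W(\mathbf m)=\prod_{1\le i<j\le n}\frac{1-\frac{x_i}{x_j}q^{m_i-m_j}}{1-\frac{x_i}{x_j}}\;\prod_{i,j=1}^n\big(q\tfrac{x_i}{x_j};q\big)_{m_i}^{-1}\;\prod_{i=1}^nx_i^{nm_i-|\mathbf m|}\;(-1)^{(n-1)|\mathbf m|}\;q^{m_2+2m_3+\cdots+(n-1)m_n+(n-1)\sum_{i=1}^n\binom{m_i}2-e_2(\mathbf m)}.$$ Then $$\sum_{\mathbf m\in\mathbb{Z}_{\ge0}^n}W(\mathbf m)\,(b;q)_{|\mathbf m|}\,\phi_{|\mathbf m|}^{(r,s,t;u,v)}(z,w|q)=\frac{(bz;q)_\infty}{(z;q)_\infty}\sum_{N=0}^\infty\frac{(r,s,t,b;q)_N}{(q,u,v,bz;q)_N}w^N.$$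
   Context: Throughout, $0<q<1$. $(\alpha;q)_0=1$, $(\alpha;q)_n=\prod_{j=0}^{n-1}(1-\alpha q^j)$, $(\alpha;q)_\infty=\prod_{j\ge0}(1-\alpha q^j)$, and $(\alpha_1,\dots,\alpha_r;q)_n=\prod_i(\alpha_i;q)_n$. $\begin{bmatrix}n\\k\end{bmatrix}=\frac{(q;q)_n}{(q;q)_k(q;q)_{n-k}}$. $$\phi_n^{(a,b,c;d,e)}(x,y|q)=\sum_{k=0}^n\begin{bmatrix}n\\k\end{bmatrix}\frac{(a,b,c;q)_k}{(d,e;q)_k}x^{n-k}y^k.$$ *)

(* Defs.v *)
From HB Require Import structures.
From mathcomp Require Import all_boot all_order all_algebra.
From mathcomp Require Import complex.
From mathcomp Require Import all_classical all_reals all_analysis.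
Set Implicit Arguments. Unset Strict Implicit. Unset Printing Implicit Defensive.
Import Order.TTheory GRing.Theory Num.Theory.
Local Open Scope ring_scope.

(* Equip R[i] with its standard normed-module (hence topological) structure
   (norm = complex modulus), so that limits of complex sequences make sense. *)
Section ComplexNormed.
Variable R : rcfType.
HB.instance Definition _ := NormedModule.copy R[i] R[i]^o.
End ComplexNormed.

Section Defs.
Variable R : realType.
Local Notation C := R[i].

Definition qpoch (q a : C) (n : nat) : C := \prod_(j < n) (1 - a * q ^+ j).

Definition qpoch_inf (q a : C) : C := limn (fun n => qpoch q a n).

Definition qbinom (q : C) (n k : nat) : C :=
  qpoch q q n / (qpoch q q k * qpoch q q (n - k)).

Definition qphi (q a b c d e x y : C) (N : nat) : C :=
  \sum_(k < N.+1) qbinom q N k *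
     ((qpoch q a k * qpoch q b k * qpoch q c k) / (qpoch q d k * qpoch q e k)) *
     x ^+ (N - k) * y ^+ k.

Definition mabs (n : nat) (m : 'I_n -> nat) : nat := \sum_(i < n) m i.
Definition me2 (n : nat) (m : 'I_n -> nat) : nat :=
  \sum_(i < n) \sum_(j < n | (i < j)%N) m i * m j.

(* The weight W(m); indices are 0-based, so m_2 + 2 m_3 + ... + (n-1) m_n
   becomes \sum_i i * m_i. *)
Definition Wt (q : C) (n : nat) (x : 'I_n -> C) (m : 'I_n -> nat) : C :=
  (\prod_(i < n) \prod_(j < n | (i < j)%N)
      ((1 - x i / x j * q ^ ((m i)%:Z - (m j)%:Z)) / (1 - x i / x j)))
  * (\prod_(i < n) \prod_(j < n) (qpoch q (q * (x i / x j)) (m i))^-1)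
  * (\prod_(i < n) x i ^ ((n * m i)%:Z - (mabs m)%:Z))
  * (-1) ^+ ((n - 1) * mabs m)
  * q ^ ((\sum_(i < n) i * m i)%:Z
         + ((n - 1) * \sum_(i < n) 'C(m i, 2))%:Z - (me2 m)%:Z).

End Defs.

(* Main.v *)
(* With y_i = x_i q^{m_i}, the weights of fixed size satisfy
     sum_{|m| = N} W(m) = 1 / (q;q)_N.
   Indeed W(m + e_i) c_i(m + e_i) = W(m) L_i(m), where
     L_i(m) = y_i^{n-1} / prod_{j <> i} (y_i - y_j),
     c_i(m) = prod_j (1 - y_i / x_j) / prod_{j <> i} (1 - y_i / y_j);
   Lagrange interpolation at the nodes y_i gives sum_i L_i(m) = 1 and
   sum_i c_i(m) = 1 - q^{|m|}, and c_i(m) = 0 if m_i = 0, so that summing over m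
   yields the recurrence (1 - q^{N+1}) S_{N+1} = S_N.
   The radius condition makes the general term O(theta^{|m|}) for some theta < 1,
   so the multiple series can be summed by layers |m| = N. The resulting double
   series is summed first along z with the q-binomial theorem; every truncation
   error is geometrically small in the truncation index. *)
Require Import Defs.
From HB Require Import structures.
From mathcomp Require Import all_boot all_order all_algebra.
From mathcomp Require Import complex.
From mathcomp Require Import all_classical all_reals all_analysis.
From mathcomp Require Import ring lra zify.
Set Implicit Arguments. Unset Strict Implicit. Unset Printing Implicit Defensive.
Import Order.TTheory GRing.Theory Num.Theory.
Import numFieldNormedType.Exports.
Local Open Scope classical_set_scope.
Local Open Scope ring_scope.
Local Notation normc := Normc.normc.

(** * Lagrange interpolation *)

Section Interpolation.
Variables (F : fieldType) (n : nat).
Implicit Types x y : 'I_n -> F.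

Lemma size_prod_XsubC_neq y (i : 'I_n) :
  size (\prod_(j | j != i) ('X - (y j)%:P)) = n.
Proof.
rewrite -big_filter size_prod_XsubC size_filter -sum1_count big_mkcond /=.
by rewrite -big_mkcond /= sum1_card cardC1 card_ord prednK //; case: i => i /(leq_ltn_trans _) ->.
Qed.

(** The difference of the two sides has size at most [n] and vanishes at the [n] distinct nodes
    [y i], so it is zero. *)
Lemma lagrange_interpolation y (P : {poly F}) : injective y -> (size P <= n)%N ->
  P = \sum_i (P.[y i] / \prod_(j | j != i) (y i - y j))
               *: \prod_(j | j != i) ('X - (y j)%:P).
Proof.
move=> yI sP; apply/eqP; rewrite -subr_eq0; apply/negPn/negP => D0.
have /(_ (codom y)) := max_poly_roots D0.
have -> : uniq (codom y) by rewrite map_inj_uniq ?enum_uniq.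
have -> : all (root (P - \sum_i (P.[y i] / \prod_(j | j != i) (y i - y j))
               *: \prod_(j | j != i) ('X - (y j)%:P))) (codom y).
  apply/allP => _ /codomP[i ->]; rewrite rootE !hornerE horner_sum (bigD1 i) //=.
  rewrite [X in _ - (_ + X)]big1 ?addr0 => [|j ji].
    rewrite hornerZ horner_prod; under [X in _ * X]eq_bigr do rewrite hornerXsubC.
    rewrite divfK ?subrr //; apply/prodf_neq0 => j ji.
    by rewrite subr_eq0 (inj_eq yI) eq_sym.
  rewrite hornerZ horner_prod [X in _ * X](bigD1 i) 1?eq_sym //= hornerXsubC subrr.
  by rewrite mul0r mulr0.
move=> /(_ isT isT); rewrite size_codom card_ord ltnNge => /negP; apply.
apply: (leq_trans (size_polyD _ _)); rewrite size_polyN geq_max sP /=.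
apply: (leq_trans (size_sum _ _ _)); apply/bigmax_leqP => i _.
by apply: leq_trans (size_scale_leq _ _) _; rewrite size_prod_XsubC_neq.
Qed.

(** Interpolate ['X^(n - 1)] and compare the coefficients of degree [n - 1]: each basis product is
    monic of that degree. *)
Lemma sum_interpolation_lead y : injective y -> (0 < n)%N ->
  \sum_i y i ^+ (n - 1) / \prod_(j | j != i) (y i - y j) = 1.
Proof.
move=> yI n0.
have := @lagrange_interpolation y ('X^(n - 1)) yI.
rewrite size_polyXn subn1 prednK // leqnn => /(_ isT) /(congr1 (fun p : {poly F} => p`_n.-1)).
rewrite coefXn eqxx coef_sum => /esym H; rewrite -[RHS]H.
apply: eq_bigr => i _; rewrite coefZ hornerXn.
set p := \prod_(_ | _) ('X - _).
suff -> : p`_n.-1 = 1 by rewrite mulr1.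
have <- : lead_coef p = p`_n.-1 by rewrite lead_coefE size_prod_XsubC_neq.
apply/eqP; rewrite -monicE; apply: monic_prod => j _; exact: monicXsubC.
Qed.

(** The leading terms of the monic polynomials with roots [x j] and [y j] cancel, so their
    difference [P] is given exactly by its values at the nodes, where the second product vanishes.
    The identity is the value at 0 divided by [\prod_j (- x j)]. *)
Lemma sum_interpolation_ratio x y : injective y ->
  (forall j, x j != 0) -> (forall j, y j != 0) ->
  \sum_i (\prod_j (1 - y i / x j)) / \prod_(j | j != i) (1 - y i / y j)
   = 1 - \prod_j (y j / x j).
Proof.
move=> yI x0 y0.
pose P := \prod_j ('X - (x j)%:P) - \prod_j ('X - (y j)%:P).
have sP z : size (\prod_(j : 'I_n) ('X - (z j)%:P) : {poly F}) = n.+1.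
  by rewrite size_prod_XsubC /index_enum -enumT size_enum_ord.
have cP z : (\prod_(j : 'I_n) ('X - (z j)%:P) : {poly F})`_n = 1.
  have /monicP : \prod_(j : 'I_n) ('X - (z j)%:P) \is monic.
    by apply: monic_prod => j _; exact: monicXsubC.
  by rewrite lead_coefE sP.
have sPn : (size P <= n)%N.
  apply/leq_sizeP => j; rewrite leq_eqVlt => /predU1P[<-|nj].
    by rewrite coefB !cP subrr.
  by rewrite coefB !nth_default ?subrr // sP.
have hE (r : pred 'I_n) z c :
    (\prod_(j | r j) ('X - (z j)%:P) : {poly F}).[c] = \prod_(j | r j) (c - z j).
  by rewrite horner_prod; apply: eq_bigr => j _; rewrite hornerXsubC.
have := lagrange_interpolation yI sPn => /(congr1 (horner^~ 0)).
rewrite hornerD hornerN !hE horner_sum.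
under eq_bigr do rewrite sub0r.
under [X in _ - X]eq_bigr do rewrite sub0r.
have X0 : \prod_j (- x j) != 0 by apply/prodf_neq0 => j _; rewrite oppr_eq0.
move=> /(congr1 (fun t => t / \prod_j (- x j))); rewrite mulrBl divff //.
rewrite -prodf_div (eq_bigr (fun j => y j / x j)); last first.
  by move=> j _; rewrite invrN mulrNN.
move=> ->; rewrite big_distrl /=; apply: eq_bigr => i _.
rewrite hornerZ hornerD hornerN !hE [X in _ - X](bigD1 i) //= subrr mul0r subr0.
under [\prod_(_ | _) (0 - _)]eq_bigr do rewrite sub0r.
have E (A B C D : F) : A / B * C / D = A / D * (C / B).
  by rewrite -mulrA [C / D]mulrC mulrACA [B^-1 * C]mulrC.
rewrite E -!prodf_div -prodfV; congr (_ * _).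
  by apply: eq_bigr => j _; field; rewrite oppr_eq0 x0.
apply: eq_bigr => j ji; have Hy : y i - y j != 0.
  by rewrite subr_eq0 (inj_eq yI) eq_sym.
field; rewrite y0 Hy /= -oppr_eq0 opprB Hy //.
Qed.

End Interpolation.

(** Raising one coordinate [i] affects only the pairs containing [i], and every [j != i] occurs in
    exactly one of them, as the larger or the smaller index. *)
Lemma prod_pairs_through (F : comRingType) n (i : 'I_n) (g : 'I_n -> F) :
  \prod_(a < n) \prod_(b < n | (a < b)%N)
    (if a == i then g b else if b == i then g a else 1) = \prod_(j | j != i) g j.
Proof.
rewrite (bigD1 i) //= [RHS](bigID (fun j : 'I_n => (i < j)%N)) /=; congr (_ * _).
  rewrite eqxx; apply: eq_bigl => j; rewrite -(inj_eq val_inj) /=.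
  by case: ltngtP.
rewrite [RHS]big_mkcond [LHS]big_mkcond; apply: eq_bigr => a _ /=.
have [->|ai] /= := eqVneq a i; first by [].
rewrite -leqNgt leq_eqVlt (inj_eq val_inj) (negPf ai) /=.
case: ltnP => ia; last first.
  by rewrite big1 // => b ab; case: eqP => // E; move: ab; rewrite E ltnNge ia.
rewrite (bigD1 i) //= eqxx big1 ?mulr1 // => b /andP[_ /negPf ->] //.
Qed.

(** * The weights and their sum over a layer *)

Section Milne.
Variables (F : fieldType) (q : F) (n : nat) (x : 'I_n -> F).
Hypotheses (q0 : q != 0) (qX : forall k, q ^+ k.+1 != 1).
Hypothesis x0 : forall i, x i != 0.
Hypothesis xq : forall i j, i != j -> forall k : int, x i / x j != q ^ k.
Hypothesis n0 : (0 < n)%N.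

Definition xshift (m : 'I_n -> nat) (i : 'I_n) : F := x i * q ^+ m i.

(* The factor q^{m_2 + 2 m_3 + ...} of the weight turns the products over pairs
   into a Vandermonde quotient in the y_i, and q^{-e_2(m)} is shared out among
   the pairs; this leaves a product of pair factors and index factors. *)
Definition pair_weight (m : 'I_n -> nat) (a b : 'I_n) : F :=
  (xshift m b - xshift m a) / (x b - x a) / q ^+ (m a * m b).

(** Since [|m|] is the sum of the [m_i], the factors [x_i^(n m_i - |m|)] and the sign regroup into
    one power with exponent [m_a] for each index [a]. *)
Definition index_weight (a : 'I_n) (k : nat) : F :=
  ((-1) ^+ (n - 1) * x a ^+ n / \prod_i x i) ^+ k * (q ^+ (n - 1)) ^+ 'C(k, 2)
  / \prod_j \prod_(l < k) (1 - q * (x a / x j) * q ^+ l).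

Definition milne_weight (m : 'I_n -> nat) : F :=
  (\prod_(a < n) \prod_(b < n | (a < b)%N) pair_weight m a b)
  * \prod_a index_weight a (m a).

Lemma xshift_neq0 m i : xshift m i != 0.
Proof. by rewrite mulf_neq0 // expf_neq0. Qed.

Lemma xshift_inj m : injective (xshift m).
Proof.
move=> i j E; apply/eqP/negPn/negP => /xq /(_ ((m j)%:Z - (m i)%:Z)) /negP; apply.
apply/eqP; rewrite expfzDr // -invr_expz -!exprnP -[x i](mulfK (expf_neq0 (m i) q0)).
by rewrite -/(xshift m i) E /xshift; field; rewrite x0 expf_neq0.
Qed.

Lemma ratio_neq1 i j k : 1 - q * (x i / x j) * q ^+ k != 0.
Proof.
rewrite subr_eq0 eq_sym; have [->|/xq] := eqVneq i j.
  by rewrite divff // mulr1 -exprS.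
move=> /(_ (- (k.+1%:Z))); apply: contraNN => /eqP H.
rewrite -invr_expz -exprnP; apply/eqP.
have qk : q ^+ k.+1 != 0 by rewrite expf_neq0.
apply: (mulIf qk); rewrite mulVf // -[RHS]H exprS; ring.
Qed.

(** Raising [m i] by one multiplies the pair factors through [i] by the product of the [g j], and
    the [i]-th index factor by [h]. The numerator of the left quotient cancels the new denominators
    in [h]; what is left collapses to the Lagrange denominators, the two signs [(-1) ^+ (n - 1)]
    cancelling. *)
Lemma milne_weight_step (m m' : 'I_n -> nat) i :
  m' i = (m i).+1 -> (forall j, j != i -> m' j = m j) ->
  milne_weight m' * (\prod_j (1 - xshift m' i / x j)
     / \prod_(j | j != i) (1 - xshift m' i / xshift m' j)) =
  milne_weight m * (xshift m i ^+ (n - 1) / \prod_(j | j != i) (xshift m i - xshift m j)).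
Proof.
move=> mi mj.
have yi : xshift m' i = q * xshift m i by rewrite /xshift mi exprS; ring.
have yj j : j != i -> xshift m' j = xshift m j by move=> ji; rewrite /xshift mj.
have sub0 j : j != i -> xshift m i - xshift m j != 0.
  by move=> ji; rewrite subr_eq0 (inj_eq (@xshift_inj m)) eq_sym.
have subx (a b : 'I_n) : (a < b)%N -> x b - x a != 0.
  move=> ab; rewrite subr_eq0; apply/negP => /eqP E.
  have ne : b != a by rewrite -(inj_eq val_inj) /= neq_ltn ab orbT.
  by have /negP := xq ne 0; apply; rewrite E divff // expr0z.
pose g j := (q * xshift m i - xshift m j) / (xshift m i - xshift m j) / q ^+ m j.
have EP : \prod_(a < n) \prod_(b < n | (a < b)%N) pair_weight m' a b =
    (\prod_(a < n) \prod_(b < n | (a < b)%N) pair_weight m a b) * \prod_(j | j != i) g j.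
  rewrite -(prod_pairs_through i g) -big_split /=; apply: eq_bigr => a _.
  rewrite -big_split /=; apply: eq_bigr => b ab; rewrite /pair_weight /g.
  have ne : b != a by rewrite -(inj_eq val_inj) /= neq_ltn ab orbT.
  have sab := subx _ _ ab.
  have [Ea|ai] := eqVneq a i.
    subst a; rewrite yi (yj _ ne) mi (mj _ ne) mulSn exprD.
    have s1 := sub0 _ ne; have s2 : xshift m b - xshift m i != 0 by rewrite -oppr_eq0 opprB.
    by field; rewrite s1 sab !expf_neq0.
  have [Eb|bi] := eqVneq b i; last by rewrite !yj // !mj // mulr1.
  subst b; rewrite yi (yj _ ai) mi (mj _ ai) mulnS exprD.
  by field; rewrite (sub0 _ ai) sab !expf_neq0.
pose h := (-1) ^+ (n - 1) * x i ^+ n / \prod_j x j * (q ^+ (n - 1)) ^+ m i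
   / \prod_j (1 - xshift m' i / x j).
have EH : \prod_a index_weight a (m' a) = \prod_a index_weight a (m a) * h.
  rewrite (bigD1 i) //= [in RHS](bigD1 i) //= [RHS]mulrAC; congr (_ * _); last first.
    by apply: eq_bigr => j ji; rewrite mj.
  rewrite /index_weight /h mi binS bin1 exprD exprS.
  have -> : \prod_j \prod_(l < (m i).+1) (1 - q * (x i / x j) * q ^+ l) =
    (\prod_j \prod_(l < m i) (1 - q * (x i / x j) * q ^+ l)) *
    \prod_j (1 - xshift m' i / x j).
    rewrite -big_split; apply: eq_bigr => j _; rewrite big_ord_recr /=; congr (_ * (1 - _)).
    by rewrite yi /xshift; ring.
  by rewrite invfM; ring.
rewrite /milne_weight EP EH.
have mulE (A B C D E : F) : A * B * (C * D) * E = A * C * (B * (D * E)) by ring.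
rewrite mulE; congr (_ * _).
have D0 : \prod_j (1 - xshift m' i / x j) != 0.
  apply/prodf_neq0 => j _; have := ratio_neq1 i j (m i).
  by rewrite /xshift mi exprS; congr (_ != 0); ring.
have -> : h * (\prod_j (1 - xshift m' i / x j)
     / \prod_(j | j != i) (1 - xshift m' i / xshift m' j)) =
   (-1) ^+ (n - 1) * x i ^+ n / \prod_j x j * (q ^+ (n - 1)) ^+ m i
   / \prod_(j | j != i) (1 - xshift m' i / xshift m' j).
  by rewrite /h !mulrA divfK.
rewrite [LHS]mulrCA -prodf_div.
(* Here [1 - y'_i / y'_j = (y_j - q y_i) / y_j] cancels the numerator of [g j], and [y_j / q ^+ m j]
   is [x j]. *)
have -> : \prod_(j | j != i) (g j / (1 - xshift m' i / xshift m' j)) =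
  \prod_(j | j != i) (- x j / (xshift m i - xshift m j)).
  apply: eq_bigr => j ji; rewrite yi (yj _ ji) /g.
  have s1 : xshift m j - q * xshift m i != 0.
    by rewrite -yi -(yj _ ji) subr_eq0 (inj_eq (@xshift_inj m')).
  have yj0 := xshift_neq0 m j.
  by rewrite /xshift in s1 yj0 sub0 *; field; rewrite !(s1, x0, expf_neq0, sub0).
have cN : \prod_(j < n | j != i) (- x j) = (-1) ^+ (n - 1) * \prod_(j < n | j != i) x j.
  rewrite (eq_bigl (fun j => j \in predC1 i)) // prodrN cardC1 card_ord subn1.
  by congr (_ * _); exact: eq_bigl.
rewrite prodf_div cN [\prod_j x j](bigD1 i) //=.
have X0 : \prod_(j < n | j != i) x j != 0 by apply/prodf_neq0.
rewrite /xshift exprMn exprAC -[in x i ^+ n](prednK n0) -subn1 exprS.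
have := sqrr_sign F (n - 1); set s := (-1) ^+ (n - 1); rewrite expr2 => ss.
transitivity (s * s * (x i ^+ (n - 1) * (q ^+ m i) ^+ (n - 1) /
   \prod_(j < n | j != i) (x i * q ^+ m i - x j * q ^+ m j))).
  field; rewrite X0 x0 /= andbT; apply/prodf_neq0 => j ji; exact: sub0.
by rewrite ss mul1r.
Qed.

(** On the layer [N.+1] the factor [1 - q ^+ N.+1] is the sum of the [c_i], on the layer [N] the sum
    of the [L_i] is 1, and the terms match through [m -> m + e_i]. The box bound [K] exceeds both
    layer sizes, so no vector is cut off. *)
Lemma milne_recurrence K N : (N.+1 < K)%N ->
  (1 - q ^+ N.+1) *
    (\sum_(f : {ffun 'I_n -> 'I_K} | (\sum_i val (f i))%N == N.+1) milne_weight (fun i => val (f i)))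
  = \sum_(f : {ffun 'I_n -> 'I_K} | (\sum_i val (f i))%N == N) milne_weight (fun i => val (f i)).
Proof.
case: K => // K NK.
pose v (f : {ffun 'I_n -> 'I_K.+1}) i := val (f i).
pose c m (i : 'I_n) := \prod_j (1 - xshift m i / x j)
     / \prod_(j | j != i) (1 - xshift m i / xshift m j).
pose L m (i : 'I_n) :=
  xshift m i ^+ (n - 1) / \prod_(j | j != i) (xshift m i - xshift m j).
have sumc m : \sum_i c m i = 1 - q ^+ (\sum_i m i).
  rewrite sum_interpolation_ratio //; [|exact: xshift_inj|exact: xshift_neq0].
  congr (1 - _); rewrite -prodrXr; apply: eq_bigr => j _.
  by rewrite /xshift mulrAC divff // mul1r.
have sumL m : \sum_i L m i = 1 by apply: sum_interpolation_lead => //; exact: xshift_inj.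
rewrite big_distrr /= (eq_bigr (fun f => \sum_i milne_weight (v f) * c (v f) i)); last first.
  by move=> f /eqP fN; rewrite -big_distrr /= sumc /v fN mulrC.
rewrite [RHS](eq_bigr (fun f => \sum_i milne_weight (v f) * L (v f) i)); last first.
  by move=> f _; rewrite -big_distrr /= sumL mulr1.
rewrite exchange_big [RHS]exchange_big /=; apply: eq_bigr => i _.
(* If [f i = 0] then [y_i = x_i], so [c] contains the factor [1 - y_i / x_i = 0]; the remaining
   vectors are those of the form [m + e_i]. *)
rewrite (bigID (fun f : {ffun 'I_n -> 'I_K.+1} => (0 < f i)%N)) /= addrC big1 ?add0r; last first.
  move=> f /andP[_]; rewrite -eqn0Ngt => /eqP fi0; have vi : v f i = 0%N := fi0.
  rewrite /c (bigD1 i) //= /xshift vi expr0 mulr1 divff // subrr.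
  by rewrite !mul0r mulr0.
pose inc (f : {ffun 'I_n -> 'I_K.+1}) : {ffun 'I_n -> 'I_K.+1} :=
  [ffun j => if j == i then inord (f j).+1 else f j].
pose dec (f : {ffun 'I_n -> 'I_K.+1}) : {ffun 'I_n -> 'I_K.+1} :=
  [ffun j => if j == i then inord (f j).-1 else f j].
have fiK (f : {ffun 'I_n -> 'I_K.+1}) : (f i < K)%N -> v (inc f) i = (v f i).+1.
  by move=> h; rewrite /v /inc ffunE eqxx /= inordK.
have fj (f : {ffun 'I_n -> 'I_K.+1}) j : j != i -> v (inc f) j = v f j.
  by move=> ji; rewrite /v /inc ffunE (negPf ji).
rewrite (reindex_onto inc dec); last first.
  move=> f /andP[_ f0]; apply/ffunP => j; rewrite !ffunE; case: eqP => // ->.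
  have p : ((f i).-1 < K.+1)%N by have := ltn_ord (f i); lia.
  by apply: val_inj; rewrite /= (inordK p) prednK // inordK.
have leN (f : {ffun 'I_n -> 'I_K.+1}) : (f i <= \sum_i v f i)%N.
  by rewrite (bigD1 i) //= leq_addr.
rewrite [LHS](eq_bigl (fun f => (\sum_i v f i)%N == N)).
  apply: eq_bigr => f /eqP fN; apply: milne_weight_step => [|j ji]; last exact: fj.
  by apply: fiK; have := leN f; rewrite fN; lia.
move=> f; have [fK|fK] := ltnP (f i) K.
  have -> : dec (inc f) = f.
    apply/ffunP => j; rewrite !ffunE; case: eqP => // ->.
    have p : ((f i).+1 < K.+1)%N by [].
    by apply: val_inj; rewrite /= (inordK p) /= inordK.
  have -> : (0 < inc f i)%N by have := fiK f fK; rewrite /v => ->.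
  rewrite eqxx !andbT (bigD1 i) //= [in RHS](bigD1 i) //=.
  have := fiK f fK; rewrite /v => ->; rewrite addSn eqSS; congr (_ + _ == _)%N.
  by apply: eq_bigr => j ji; have := fj f j ji.
(* Here f i = K: inord falls back to 0 in inc f, and the size of f exceeds N. *)
have -> : ((\sum_i0 v f i0)%N == N) = false by have := leN f; lia.
suff -> : (0 < inc f i)%N = false by rewrite andbF.
rewrite /inc ffunE eqxx /inord /insubd insubF //=.
by apply/negbTE; rewrite -leqNgt ltnS.
Qed.

Lemma milne_sum K N : (N < K)%N ->
  \sum_(f : {ffun 'I_n -> 'I_K} | (\sum_i val (f i))%N == N) milne_weight (fun i => val (f i))
  = (\prod_(l < N) (1 - q * q ^+ l))^-1.
Proof.
elim: N => [|N IH] NK.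
  rewrite big_ord0 invr1; case: K NK => // K _.
  rewrite (big_pred1 [ffun => ord0]) => [|f /=].
    have W0 (f : 'I_n -> nat) : (forall i, f i = 0%N) -> milne_weight f = 1.
      move=> f0; rewrite /milne_weight [X in _ * X]big1 ?mulr1 => [|a _].
        apply: big1 => a _; apply: big1 => b ab.
        rewrite /pair_weight /xshift !f0 !expr0 !mulr1 divr1 divff // subr_eq0.
        have ne : b != a by rewrite -(inj_eq val_inj) /= neq_ltn ab orbT.
        apply/negP => /eqP E.
        by have /negP := xq ne 0; apply; rewrite E divff // expr0z.
      by rewrite /index_weight f0 !expr0 mul1r big1 ?invr1 ?mulr1 // => j _; rewrite big_ord0.
    by apply: W0 => i; rewrite ffunE.
  rewrite sum_nat_eq0; apply/forallP/eqP => [f0|-> i]; last by rewrite ffunE.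
  by apply/ffunP => i; apply: val_inj; rewrite ffunE; apply/eqP; exact: f0.
have q1 : 1 - q ^+ N.+1 != 0 by rewrite subr_eq0 eq_sym.
apply: (mulfI q1); rewrite milne_recurrence // IH ?(ltnW NK) // big_ord_recr /=.
by rewrite -exprS invfM mulrCA divff // mulr1.
Qed.
End Milne.

(** * Complex sequences with geometric errors *)

Section ComplexModulus.
Variable R : realType.
Implicit Types (z : R[i]) (a : R).

(* The norm of R[i] takes its values in R[i]; estimates are made on the
   real-valued modulus, where lra applies. *)
Lemma norm_normc z : `|z| = ((normc z)%:C)%C. Proof. by []. Qed.

Lemma normc_real a : normc (a%:C)%C = `|a|.
Proof. by rewrite /= expr0n /= addr0 sqrtr_sqr. Qed.

Lemma normc_ge0 z : 0 <= normc z.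
Proof. by case: z => a b; rewrite /= sqrtr_ge0. Qed.

Lemma normc_gt0 z : z != 0 -> 0 < normc z.
Proof.
move=> z0; rewrite lt_neqAle normc_ge0 andbT eq_sym.
by apply: contraNN z0 => /eqP /Normc.eq0_normc ->.
Qed.

Lemma normcD z1 z2 : normc (z1 + z2) <= normc z1 + normc z2.
Proof. exact: le_normcD. Qed.

Lemma normcX z k : normc (z ^+ k) = normc z ^+ k.
Proof. by elim: k => [|k IH]; rewrite ?expr0 ?Normc.normc1 // !exprS Normc.normcM IH. Qed.

Lemma normc_prod (I : Type) (r : seq I) (P : pred I) (F : I -> R[i]) :
  normc (\prod_(i <- r | P i) F i) = \prod_(i <- r | P i) normc (F i).
Proof. by apply: big_morph; [exact: Normc.normcM|exact: Normc.normc1]. Qed.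

Lemma normc_sum (I : Type) (r : seq I) (P : pred I) (F : I -> R[i]) :
  normc (\sum_(i <- r | P i) F i) <= \sum_(i <- r | P i) normc (F i).
Proof.
elim/big_rec2: _ => [|i y x _ H]; first by rewrite Normc.normc0.
by apply: (le_trans (normcD _ _)); rewrite lerD2l.
Qed.

Lemma normc_le_ReIm z : normc z <= `|complex.Re z| + `|complex.Im z|.
Proof.
case: z => a b /=.
rewrite -[leRHS]ger0_norm ?addr_ge0 // -sqrtr_sqr ler_wsqrtr // sqrrD !real_normK ?num_real //.
by rewrite lerD2r lerDl mulrn_wge0 // mulr_ge0.
Qed.

Lemma normRe_le z : `|complex.Re z| <= normc z.
Proof. by case: z => a b /=; rewrite -sqrtr_sqr ler_wsqrtr // lerDl sqr_ge0. Qed.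

Lemma normIm_le z : `|complex.Im z| <= normc z.
Proof. by case: z => a b /=; rewrite -sqrtr_sqr ler_wsqrtr // lerDr sqr_ge0. Qed.

Lemma cvg_normcP (u : nat -> R[i]) (l : R[i]) :
  (fun k => normc (u k - l)) @ \oo --> (0 : R) <-> u @ \oo --> l.
Proof.
split=> H.
  apply/cvgrPdist_lt => e e0.
  (* A positive element of [R[i]] is real, so its real part is a tolerance for the real sequence. *)
  have : 0 < complex.Re e by move: e0; rewrite ltcE => /andP[].
  have eE : e = ((complex.Re e)%:C)%C.
    by apply/esym/RRe_real/ger0_real/ltW.
  move/cvgrPdist_lt : H => H /H; apply: filterS => k.
  rewrite sub0r normrN ger0_norm ?normc_ge0 // => ue.
  by rewrite norm_normc eE ltcR -normcN opprB.
apply/cvgrPdist_lt => e e0.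
move/cvgrPdist_lt : H => /(_ (e%:C)%C); rewrite ltcR => /(_ e0).
apply: filterS => k; rewrite norm_normc ltcR -normcN opprB => ue.
by rewrite sub0r normrN ger0_norm ?normc_ge0.
Qed.

(** [normc (l - l')] is at most [normc (u k - l) + normc (u k - l')], which tends to 0 in [R]. *)
Lemma cvgc_unique (u : nat -> R[i]) (l l' : R[i]) :
  u @ \oo --> l -> u @ \oo --> l' -> l = l'.
Proof.
move=> /(proj2 (@cvg_normcP u l)) ul /(proj2 (@cvg_normcP u l')) ul'.
have D : (fun k => normc (u k - l) + normc (u k - l')) @ \oo --> (0 : R).
  by rewrite -[0]addr0; apply: cvgD.
apply/eqP; rewrite -subr_eq0; apply/eqP/Normc.eq0_normc/eqP.
rewrite eq_le normc_ge0 andbT.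
rewrite -(cvg_lim (@Rhausdorff R) D); apply: limr_ge; first by apply/cvg_ex; exists 0.
near=> k; rewrite /= -(normcN (u k - l)) opprB.
apply: le_trans (normcD _ _); rewrite addrA subrK //.
Unshelve. all: by end_near. Qed.

Lemma cvgc_lim (u : nat -> R[i]) (l : R[i]) : u @ \oo --> l -> limn u = l.
Proof.
move=> ul; have uc : cvgn u by apply/cvg_ex; exists l.
exact: (cvgc_unique uc ul).
Qed.

Lemma cvg_geometric0 (C s : R) : 0 <= s < 1 -> (fun k => C * s ^+ k) @ \oo --> (0 : R).
Proof. by move=> /andP[s0 s1]; apply: cvg_geometric; rewrite ger0_norm. Qed.

(** Compares a sequence with one of known limit. With a constant [v] it turns the error bounds of
    the next lemmas into convergence. *)
Lemma geometric_error_cvg (u v : nat -> R[i]) (l : R[i]) (C s : R) : 0 <= s < 1 ->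
  (forall k, normc (u k - v k) <= C * s ^+ k) -> v @ \oo --> l -> u @ \oo --> l.
Proof.
move=> s01 H /(proj2 (@cvg_normcP v l)) vl; apply/(proj1 (@cvg_normcP u l)).
apply: (@squeeze_cvgr _ _ _ _ (cst 0) (fun k => C * s ^+ k + normc (v k - l))).
- near=> k; rewrite normc_ge0 /=.
  have -> : u k - l = (u k - v k) + (v k - l) by rewrite addrA subrK.
  by apply: (le_trans (normcD _ _)); rewrite lerD2r.
- exact: cvg_cst.
- by rewrite -[0]addr0; apply: cvgD => //; exact: cvg_geometric0.
Unshelve. all: by end_near. Qed.

Lemma real_geometric_increments (u : nat -> R) (C s : R) : 0 <= s < 1 -> 0 <= C ->
  (forall k, `|u k.+1 - u k| <= C * s ^+ k) ->
  exists l, forall k, `|u k - l| <= C / (1 - s) * s ^+ k.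
Proof.
move=> /andP[s0 s1] C0 H.
pose d k := C / (1 - s) * s ^+ k.
have s1' : 0 < 1 - s by rewrite subr_gt0.
have d0 k : 0 <= d k by rewrite mulr_ge0 ?exprn_ge0 // divr_ge0 // ltW.
have dS k : d k = d k.+1 + C * s ^+ k.
  by rewrite /d exprS; field; rewrite gt_eqF.
(* d k is the tail of the geometric majorant, so u - d increases and u + d
   decreases. *)
have am : nondecreasing_seq (fun k => u k - d k).
  apply/nondecreasing_seqP => k; have := H k; rewrite ler_norml => /andP[h1 h2].
  by rewrite /= dS; lra.
have bm : nonincreasing_seq (fun k => u k + d k).
  apply/nonincreasing_seqP => k; have := H k; rewrite ler_norml => /andP[h1 h2].
  by rewrite /= (dS k); lra.
have ab j k : u j - d j <= u k + d k.
  apply: (@le_trans _ _ (u (maxn j k) - d (maxn j k))).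
    by apply: am; rewrite leq_maxl.
  apply: (@le_trans _ _ (u (maxn j k) + d (maxn j k))).
    by have := d0 (maxn j k); lra.
  by apply: bm; rewrite leq_maxr.
have ac : cvgn (fun k => u k - d k).
  by apply: nondecreasing_is_cvgn => //; exists (u 0%N + d 0%N) => _ [j _ <-].
exists (limn (fun k => u k - d k)) => k; rewrite ler_distlC; apply/andP; split.
  exact: nondecreasing_cvgn_le.
by apply: limr_le => //; near=> j; exact: ab.
Unshelve. all: by end_near. Qed.

(** The real and imaginary parts are treated separately, whence the factor 2. *)
Lemma geometric_increments (u : nat -> R[i]) (C s : R) : 0 <= s < 1 -> 0 <= C ->
  (forall k, normc (u k.+1 - u k) <= C * s ^+ k) ->
  exists l, forall k, normc (u k - l) <= 2 * C / (1 - s) * s ^+ k.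
Proof.
move=> s01 C0 H.
have [|a Ha] := @real_geometric_increments (fun k => complex.Re (u k)) C s s01 C0.
  move=> k; apply: le_trans (H k); apply: le_trans (normRe_le _).
  by case: (u k.+1) (u k) => [? ?] [? ?].
have [|b Hb] := @real_geometric_increments (fun k => complex.Im (u k)) C s s01 C0.
  move=> k; apply: le_trans (H k); apply: le_trans (normIm_le _).
  by case: (u k.+1) (u k) => [? ?] [? ?].
exists (a +i* b)%C => k; apply: (le_trans (normc_le_ReIm _)).
have -> : 2 * C / (1 - s) * s ^+ k = C / (1 - s) * s ^+ k + C / (1 - s) * s ^+ k by ring.
by apply: lerD; [move: (Ha k)|move: (Hb k)]; case: (u k).
Qed.

(** Absorbs a linear factor into a larger ratio. With [t = r / s < 1], each of the [k.+1] terms of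
    [1 + t + ... + t ^+ k] is at least [t ^+ k], and their sum is at most [(1 - t)^-1]. *)
Lemma natSM_geometric (r s : R) k : 0 <= r < s -> k.+1%:R * r ^+ k <= s / (s - r) * s ^+ k.
Proof.
move=> /andP[r0 rs]; have s0 : 0 < s by exact: le_lt_trans rs.
pose t := r / s; have t0 : 0 <= t by rewrite divr_ge0 // ltW.
have t1 : t < 1 by rewrite ltr_pdivrMr // mul1r.
have -> : r = t * s by rewrite divfK // gt_eqF.
have -> : s / (s - t * s) = (1 - t)^-1.
  by field; rewrite gt_eqF ?gt_eqF // ?subr_gt0 // gtr_pMl.
rewrite exprMn mulrA ler_wpM2r ?exprn_ge0 // ?(ltW s0) //.
rewrite -[leRHS]mul1r ler_pdivlMr ?subr_gt0 //.
have E : 1 - t ^+ k.+1 = (1 - t) * \sum_(i < k.+1) t ^+ i.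
  by rewrite -opprB subrX1 -mulNr opprB.
apply: (@le_trans _ _ (1 - t ^+ k.+1)); last by rewrite gerBl exprn_ge0.
rewrite E mulrC ler_wpM2l ?subr_ge0 ?(ltW t1) //.
rewrite mulr_natl -[X in _ *+ X]card_ord -sumr_const; apply: ler_sum => i _.
by apply: ler_wiXn2l => //; [exact: ltW|rewrite -ltnS].
Qed.

End ComplexModulus.

(** * q-shifted factorials *)

Section QPochhammer.
Variables (R : realType) (q : R).
Hypotheses (q0 : 0 < q) (q1 : q < 1).
Local Notation Q := ((q%:C)%C : R[i]).
Implicit Types a b y z : R[i].

Let q01 : 0 <= q < 1. Proof. by rewrite q1 ltW. Qed.
Let normcQ k : normc (Q ^+ k) = q ^+ k.
Proof. by rewrite normcX normc_real ger0_norm // ltW. Qed.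

Lemma qpochS (p a : R[i]) k : qpoch p a k.+1 = qpoch p a k * (1 - a * p ^+ k).
Proof. by rewrite /qpoch big_ord_recr. Qed.

Lemma qpochD (p a : R[i]) j k : qpoch p a (j + k) = qpoch p a j * qpoch p (a * p ^+ j) k.
Proof.
rewrite /qpoch big_split_ord /=; congr (_ * _); apply: eq_bigr => i _.
by rewrite exprD mulrA.
Qed.

Lemma geometric_sum_le k : \sum_(j < k) q ^+ j <= (1 - q)^-1.
Proof.
have q1' : 0 < 1 - q by rewrite subr_gt0.
rewrite -[leRHS]mul1r ler_pdivlMr // mulrC -opprB mulNr -subrX1 opprB gerBl exprn_ge0 //.
exact: ltW.
Qed.

(** Each factor is at most [1 + A q^j <= exp (A q^j)]. The bound depends only on [A], hence holds
    for all [a * Q ^+ j] at once. *)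
Lemma normc_qpoch_le (A : R) a k : normc a <= A -> normc (qpoch Q a k) <= expR (A / (1 - q)).
Proof.
move=> aA; have A0 : 0 <= A := le_trans (normc_ge0 _) aA.
rewrite /qpoch normc_prod.
apply: (@le_trans _ _ (\prod_(j < k) expR (A * q ^+ j))).
  apply: ler_prod => j _; rewrite normc_ge0 /=.
  apply: le_trans (expR_ge1Dx _); apply: (le_trans (normcD _ _)).
  by rewrite Normc.normc1 normcN Normc.normcM normcQ lerD2l ler_wpM2r // exprn_ge0 // ltW.
rewrite -expR_sum ler_expR -mulr_sumr ler_wpM2l //; exact: geometric_sum_le.
Qed.

Lemma prod_1B_ge (t : nat -> R) k : (forall j, 0 <= t j <= 1) ->
  1 - \sum_(j < k) t j <= \prod_(j < k) (1 - t j).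
Proof.
move=> t01; elim: k => [|k IH]; first by rewrite !big_ord0 subr0.
rewrite !big_ord_recr /=; have /andP[t0 t1] := t01 k.
have P1 : \prod_(j < k) (1 - t j) <= 1.
  by apply: prodr_ile1 => j _; have /andP[? ?] := t01 j; rewrite subr_ge0 gerBl; apply/andP.
rewrite mulrBr mulr1 opprD addrA lerB //.
by rewrite ler_piMl.
Qed.

(** No factor vanishes, because [a] is not a power [Q ^- k]. From some [J] on the terms [A q^j] add
    up to at most 1/2, so the remaining product is at least 1/2, and a minimum over finitely many
    initial products suffices. *)
Lemma normc_qpoch_ge a : (forall k, a != Q ^- k) ->
  exists2 c : R, 0 < c & forall k, c <= normc (qpoch Q a k).
Proof.
move=> aq; pose A := normc a.
have A0 : 0 <= A := normc_ge0 _.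
have q1' : 0 < 1 - q by rewrite subr_gt0.
have Q0 k : Q ^+ k != 0.
  by rewrite expf_neq0 // fmorph_eq0 gt_eqF.
have fac0 k : 1 - a * Q ^+ k != 0.
  rewrite subr_eq0 eq_sym; apply: contra (aq k) => /eqP E; apply/eqP.
  by apply: (mulIf (Q0 k)); rewrite E mulVf.
have nz k : 0 < normc (qpoch Q a k).
  by apply: normc_gt0; apply/prodf_neq0.
have [J HJ] : exists J, A * q ^+ J / (1 - q) <= 1 / 2.
  have := @cvg_geometric0 R (A / (1 - q)) q q01.
  move/cvgrPdist_lt => /(_ (1/2)) []; first by rewrite divr_gt0.
  move=> J _ HJ; exists J; have := HJ J (leqnn _).
  by rewrite /= sub0r normrN => /ltW /(le_trans (ler_norm _)); rewrite mulrAC.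
have tail k : 1 / 2 <= normc (qpoch Q (a * Q ^+ J) k).
  rewrite /qpoch normc_prod.
  have tj j : 0 <= A * q ^+ J * q ^+ j by rewrite !mulr_ge0 ?exprn_ge0 // ltW.
  have tA : A * q ^+ J <= 1 / 2.
    apply: le_trans HJ; rewrite ler_pdivlMr // ler_piMr //.
      by rewrite mulr_ge0 // exprn_ge0 // ltW.
    by rewrite gerBl ltW.
  have tj1 j : A * q ^+ J * q ^+ j <= 1.
    apply: (@le_trans _ _ (1 / 2 * 1)); last by lra.
    by rewrite ler_pM // ?exprn_ge0 ?exprn_ile1 ?mulr_ge0 ?exprn_ge0 // ltW.
  apply: (@le_trans _ _ (\prod_(j < k) (1 - A * q ^+ J * q ^+ j))).
    apply: le_trans (@prod_1B_ge (fun j => A * q ^+ J * q ^+ j) k _); last first.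
      by move=> j; rewrite tj tj1.
    rewrite -mulr_sumr; have := geometric_sum_le k => G.
    have : A * q ^+ J * (\sum_(j < k) q ^+ j) <= 1 / 2.
      by apply: le_trans HJ; rewrite ler_wpM2l // mulr_ge0 // exprn_ge0 // ltW.
    by lra.
  apply: ler_prod => j _; rewrite subr_ge0 tj1 /= -/A.
  have -> : A * q ^+ J * q ^+ j = normc (a * Q ^+ J * Q ^+ j).
    by rewrite !Normc.normcM !normcQ.
  rewrite lerBlDr -[1]Normc.normc1 -[X in normc X](subrK (a * Q ^+ J * Q ^+ j)).
  exact: normcD.
pose c := \big[Num.min/normc (qpoch Q a J) / 2]_(i < J) normc (qpoch Q a i).
exists c; first by rewrite lt_bigmin ?divr_gt0 // => i _; exact: nz.
move=> k; have [kJ|Jk] := ltnP k J.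
  exact: (@bigmin_le_cond _ _ _ _ (Ordinal kJ)).
rewrite -(subnKC Jk) qpochD Normc.normcM.
apply: (@le_trans _ _ (normc (qpoch Q a J) / 2)); first exact: bigmin_le_id.
by rewrite ler_wpM2l ?(ltW (nz _)) // -[_^-1]mul1r.
Qed.

Lemma cvg_qpoch a : qpoch Q a @ \oo --> qpoch_inf Q a.
Proof.
have [|k|l Hl] := @geometric_increments R (qpoch Q a) (normc a * expR (normc a / (1 - q))) q q01.
- by rewrite mulr_ge0 ?normc_ge0 ?expR_ge0.
- have -> : qpoch Q a k.+1 - qpoch Q a k = - (qpoch Q a k * (a * Q ^+ k)).
    by rewrite qpochS; ring.
  rewrite normcN !Normc.normcM normcQ mulrCA mulrA ler_wpM2r ?exprn_ge0 ?(ltW q0) //.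
  by rewrite ler_wpM2l ?normc_ge0 // normc_qpoch_le.
apply/cvg_ex; exists l; apply: (geometric_error_cvg q01 Hl); exact: cvg_cst.
Qed.

Lemma qpoch_infD a k : qpoch_inf Q a = qpoch Q a k * qpoch_inf Q (a * Q ^+ k).
Proof.
have H : (fun j => qpoch Q a (j + k)) @ \oo --> qpoch_inf Q a.
  by rewrite (cvg_shiftn k (qpoch Q a)); exact: cvg_qpoch.
apply: (cvgc_unique H).
under eq_fun do rewrite addnC qpochD.
apply: cvgM; [exact: cvg_cst|exact: cvg_qpoch].
Qed.

Lemma qpoch_inf_neq0 a : (forall k, a != Q ^- k) -> qpoch_inf Q a != 0.
Proof.
move=> /normc_qpoch_ge[c c0 H]; apply/eqP => E.
have := @cvg_qpoch a; rewrite E => /(proj2 (@cvg_normcP R (qpoch Q a) 0)).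
move/cvgrPdist_lt => /(_ _ c0) [N _ /(_ N (leqnn N))] /=.
rewrite subr0 sub0r normrN ger0_norm ?normc_ge0 // ltNge => /negP; apply; exact: H.
Qed.

Lemma lt1_neq_qexp z : normc z < 1 -> forall k, z != Q ^- k.
Proof.
move=> z1 k; apply: contraTneq z1 => ->; rewrite -leNgt Normc.normcV normcQ.
by rewrite invf_ge1 ?exprn_gt0 // exprn_ile1 // ltW.
Qed.

Lemma qexp_neq k : Q != Q ^- k.
Proof. by apply: lt1_neq_qexp; rewrite normc_real ger0_norm // ltW. Qed.

Lemma qpoch_neq0 a k : (forall j, a != Q ^- j) -> qpoch Q a k != 0.
Proof.
move=> /normc_qpoch_ge[c c0 H]; apply/eqP => E.
by have := H k; rewrite E Normc.normc0 leNgt c0.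
Qed.

End QPochhammer.

(** * The q-binomial theorem *)

Section QBinomial.
Variables (R : realType) (q : R).
Hypotheses (q0 : 0 < q) (q1 : q < 1).
Local Notation Q := ((q%:C)%C : R[i]).
Implicit Types a b y z : R[i].

Let q01 : 0 <= q < 1. Proof. by rewrite q1 ltW. Qed.
Let normcQ k : normc (Q ^+ k) = q ^+ k.
Proof. by rewrite normcX normc_real ger0_norm // ltW. Qed.

(** A truncated form of [(1 - y) F(y) = (1 - b y) F(y Q)] for the q-binomial series [F]; the last
    term is the boundary term, which disappears in the limit when [|y| < 1]. *)
Lemma q_binomial_step b y k (c := fun j => qpoch Q b j / qpoch Q Q j) :
  (1 - y) * (\sum_(j < k) c j * y ^+ j) =
  (1 - b * y) * (\sum_(j < k) c j * (y * Q) ^+ j) - c k * (1 - Q ^+ k) * y ^+ k.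
Proof.
elim: k => [|k IH]; first by rewrite !big_ord0 expr0; ring.
rewrite !big_ord_recr /= !mulrDr IH /c !qpochS exprMn !exprS.
have Q1 : 1 - Q * Q ^+ k != 0.
  by have := qpoch_neq0 q0 q1 k.+1 (qexp_neq q0 q1); rewrite qpochS mulf_eq0 => /norP[].
have Q0 := qpoch_neq0 q0 q1 k (qexp_neq q0 q1).
by field; rewrite Q0 Q1.
Qed.

(** The functional equation is iterated along [y Q^k]. One constant [D] serves all [b] and [y] in
    the given discs, because the estimate is later applied to all the parameters [b Q^k]
    together. *)
Lemma q_binomial (B s : R) : 0 <= s < 1 -> exists2 D : R, 0 <= D &
  forall b y k, normc b <= B -> normc y <= s ->
  normc (\sum_(j < k) qpoch Q b j / qpoch Q Q j * y ^+ j - qpoch_inf Q (b * y) / qpoch_inf Q y)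
    <= D * s ^+ k.
Proof.
move=> /andP[s0 s1]; have [c c0 Hc] := normc_qpoch_ge q0 q1 (qexp_neq q0 q1).
pose C := expR (B / (1 - q)) / c; pose D := 2 * C / (1 - s).
have C0 : 0 <= C by rewrite divr_ge0 ?expR_ge0 // ltW.
have D0 : 0 <= D by rewrite /D divr_ge0 ?subr_ge0 ?(ltW s1) // mulr_ge0.
pose S b y k := \sum_(j < k) qpoch Q b j / qpoch Q Q j * y ^+ j.
have coefC b j : normc b <= B -> normc (qpoch Q b j / qpoch Q Q j) <= C.
  move=> bB; rewrite Normc.normcM Normc.normcV.
  rewrite ler_pM ?invr_ge0 ?normc_ge0 //; first exact: normc_qpoch_le.
  by rewrite lef_pV2 ?posrE // (lt_le_trans c0).
pose F b y := limn (S b y).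
(* The error is stated with [normc y ^+ k], not [s ^+ k]: at [y * Q ^+ j] with [k = 1], where the
   partial sum is 1, it shows that [F b (y * Q ^+ j)] tends to 1. *)
have HF b y k : normc b <= B -> normc y <= s -> normc (S b y k - F b y) <= D * normc y ^+ k.
  move=> bB ys; have y1 : normc y < 1 := le_lt_trans ys s1.
  have y01 : 0 <= normc y < 1 by rewrite normc_ge0.
  have [|l Hl] := geometric_increments (u := S b y) y01 C0.
    move=> j; have -> : S b y j.+1 - S b y j = qpoch Q b j / qpoch Q Q j * y ^+ j.
      by rewrite /S big_ord_recr /=; ring.
    rewrite Normc.normcM normcX.
    by rewrite ler_wpM2r ?exprn_ge0 ?normc_ge0 ?coefC.
  have Sl : S b y @ \oo --> l by apply: (geometric_error_cvg y01 Hl); exact: cvg_cst.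
  rewrite /F (cvgc_lim Sl).
  apply: le_trans (Hl k) _; rewrite ler_wpM2r ?exprn_ge0 ?normc_ge0 //.
  have C2 : 0 <= 2 * C by rewrite mulr_ge0.
  rewrite /D (ler_wpM2l C2) // lef_pV2 ?posrE ?subr_gt0 //; lra.
have SF b y : normc b <= B -> normc y <= s -> S b y @ \oo --> F b y.
  move=> bB ys; have y01 : 0 <= normc y < 1 by rewrite normc_ge0 (le_lt_trans ys).
  by apply: (geometric_error_cvg y01 (fun k => HF b y k bB ys)); exact: cvg_cst.
have yQs y k : normc y <= s -> normc (y * Q ^+ k) <= s.
  move=> ys; rewrite Normc.normcM normcQ; apply: le_trans ys.
  by rewrite ler_piMr ?normc_ge0 // exprn_ile1 // ltW.
have step b y : normc b <= B -> normc y <= s -> (1 - y) * F b y = (1 - b * y) * F b (y * Q).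
  move=> bB ys; have y01 : 0 <= normc y < 1 by rewrite normc_ge0 (le_lt_trans ys).
  have L1 : (fun k => (1 - y) * S b y k) @ \oo --> (1 - y) * F b y.
    by apply: cvgM; [exact: cvg_cst|exact: SF].
  have L2 : (fun k => (1 - b * y) * S b (y * Q) k) @ \oo --> (1 - b * y) * F b (y * Q).
    apply: cvgM; [exact: cvg_cst|apply: SF => //].
    by have := yQs y 1 ys; rewrite expr1.
  apply: (cvgc_unique L1); apply: (geometric_error_cvg (C := 2 * C) y01 _ L2) => k.
  rewrite /S q_binomial_step addrAC subrr add0r normcN !Normc.normcM normcX.
  rewrite ler_wpM2r ?exprn_ge0 ?normc_ge0 // mulrC ler_pM ?mulr_ge0 ?normc_ge0 //.
    apply: (le_trans (normcD _ _)); rewrite Normc.normc1 normcN normcQ.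
    have : q ^+ k <= 1 by apply: exprn_ile1 => //; exact: ltW.
    by lra.
  by rewrite -Normc.normcM coefC.
(* Since F b (y Q^k) tends to 1, the next identity yields the theorem. *)
have iter b y k : normc b <= B -> normc y <= s ->
    F b y * qpoch Q y k = qpoch Q (b * y) k * F b (y * Q ^+ k).
  move=> bB ys; elim: k => [|k IH].
    by rewrite /qpoch !big_ord0 expr0 !mulr1 mul1r.
  rewrite !qpochS mulrA IH exprSr [y * (_ * _)]mulrA.
  transitivity (qpoch Q (b * y) k * ((1 - y * Q ^+ k) * F b (y * Q ^+ k))); first by ring.
  by rewrite step ?yQs //; ring.
exists D => // b y k bB ys.
suff <- : F b y = qpoch_inf Q (b * y) / qpoch_inf Q y.
  apply: le_trans (HF b y k bB ys) _; rewrite ler_wpM2l //.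
  by rewrite lerXn2r ?nnegrE ?normc_ge0.
have y1 : normc y < 1 := le_lt_trans ys s1.
have yinf : qpoch_inf Q y != 0 by apply: qpoch_inf_neq0 => //; exact: lt1_neq_qexp.
apply: (canRL (mulfK yinf)).
have L1 : (fun k => F b y * qpoch Q y k) @ \oo --> F b y * qpoch_inf Q y.
  by apply: cvgM; [exact: cvg_cst|exact: cvg_qpoch].
have L2 : (fun k => qpoch Q (b * y) k * F b (y * Q ^+ k)) @ \oo --> qpoch_inf Q (b * y).
  rewrite -[qpoch_inf Q (b * y)]mulr1; apply: cvgM; first exact: cvg_qpoch.
  apply: (geometric_error_cvg (v := fun=> 1) (C := D * s) q01) => [j|]; last exact: cvg_cst.
  have := HF b (y * Q ^+ j) 1%N bB (yQs y j ys).
  rewrite /S big_ord1 /qpoch !big_ord0 divr1 mul1r expr0 expr1 -normcN opprB => /le_trans; apply.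
  rewrite -mulrA ler_wpM2l // Normc.normcM normcQ ler_wpM2r // exprn_ge0 //.
  exact: ltW.
apply: (cvgc_unique L1); under eq_fun do rewrite iter //; exact: L2.
Qed.

End QBinomial.

(** * Growth of the weights *)

Lemma expfz_subn (F : fieldType) (y : F) (j k : nat) :
  y != 0 -> y ^ (j%:Z - k%:Z) = y ^+ j / y ^+ k.
Proof. by move=> y0; rewrite expfzDr // -invr_expz -!exprnP. Qed.

(** With [y_i = x_i q^(m_i)], the factor [1 - (x_i / x_j) q^(m_i - m_j)] equals [(y_j - y_i) / y_j];
    the powers [q^(m_j)] in these denominators are cancelled by the factor with exponent
    [\sum_i i * m i]. *)
Lemma Wt_milne_weight (R : realType) (p : R[i]) n (x : 'I_n -> R[i]) (m : 'I_n -> nat) :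
  p != 0 -> (forall i, x i != 0) -> (forall i j, i != j -> x i != x j) ->
  Wt p x m = milne_weight p x m.
Proof.
move=> p0 x0 xx; rewrite /Wt /milne_weight.
have E2 : \prod_(a < n) \prod_(b < n | (a < b)%N) pair_weight p x m a b =
  (\prod_(i < n) \prod_(j < n | (i < j)%N)
      ((1 - x i / x j * p ^ ((m i)%:Z - (m j)%:Z)) / (1 - x i / x j)))
  * (p ^+ (\sum_(i < n) i * m i) / p ^+ me2 m).
  (* Counting from 0, index [b] is the larger member of exactly [b] pairs. *)
  have -> : p ^+ (\sum_(i < n) i * m i)
     = \prod_(a < n) \prod_(b < n | (a < b)%N) p ^+ m b.
    rewrite (exchange_big_dep predT) //= -prodrXr; apply: eq_bigr => b _.
    rewrite -(big_ord_widen_cond n predT (fun=> p ^+ m b)) ?(ltnW (ltn_ord b)) //.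
    by rewrite prodr_const card_ord -exprM mulnC.
  have -> : p ^+ me2 m = \prod_(a < n) \prod_(b < n | (a < b)%N) p ^+ (m a * m b).
    by rewrite /me2 -prodrXr; apply: eq_bigr => a _; rewrite -prodrXr.
  rewrite -prodf_div -big_split /=; apply: eq_bigr => a _.
  rewrite -prodf_div -big_split /=; apply: eq_bigr => b ab.
  have ne : a != b by rewrite -(inj_eq val_inj) /= neq_ltn ab.
  rewrite /pair_weight /xshift expfz_subn //.
  have d1 : x b - x a != 0 by rewrite subr_eq0 eq_sym xx.
  by field; rewrite d1 x0 !expf_neq0.
have E3 : \prod_a index_weight p x a (m a) =
  (\prod_(i < n) \prod_(j < n) (qpoch p (p * (x i / x j)) (m i))^-1)
  * (\prod_(i < n) x i ^ ((n * m i)%:Z - (mabs m)%:Z))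
  * (-1) ^+ ((n - 1) * mabs m) * p ^+ ((n - 1) * \sum_(i < n) 'C(m i, 2)).
  have -> : \prod_(i < n) x i ^ ((n * m i)%:Z - (mabs m)%:Z) =
     \prod_(i < n) (x i ^+ n / \prod_j x j) ^+ m i.
    under [LHS]eq_bigr => i _ do rewrite (expfz_subn _ _ (x0 i)) exprM.
    rewrite prodf_div prodrXl; under [RHS]eq_bigr do rewrite exprMn exprVn.
    by rewrite [RHS]big_split /= prodfV prodrXr.
  have -> : (-1 : R[i]) ^+ ((n - 1) * mabs m) = \prod_(i < n) ((-1) ^+ (n - 1)) ^+ m i.
    by rewrite exprM -prodrXr.
  have -> : p ^+ ((n - 1) * \sum_(i < n) 'C(m i, 2)) =
      \prod_(i < n) (p ^+ (n - 1)) ^+ 'C(m i, 2).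
    by rewrite exprM -prodrXr.
  rewrite -!big_split /=; apply: eq_bigr => a _.
  by rewrite /index_weight prodfV /qpoch -mulrA [X in X ^+ m a * _]mulrAC !exprMn; ring.
rewrite E2 E3 -PoszD expfz_subn // exprD; ring.
Qed.

Lemma bin2_double k : (2 * 'C(k, 2) + k = k * k)%N.
Proof. by elim: k => // k IH; rewrite binS bin1; nia. Qed.

(** Sum [2 m_i m_j <= m_i^2 + m_j^2] over the pairs; each index lies in [n - 1] of them, and
    [k^2 = 2 'C(k, 2) + k]. The quadratic exponents of [q] in the weight thus cost at most
    [q^(-(n - 1) |m| / 2)], which is the origin of [q^((n - 1) / 2)] in the radius. *)
Lemma me2_le n (m : 'I_n -> nat) :
  (2 * me2 m <= (n - 1) * (2 * \sum_(i < n) 'C(m i, 2) + \sum_(i < n) m i))%N.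
Proof.
rewrite [in leqRHS]big_distrr -big_split /= [in leqRHS]big_distrr /=.
have -> : (\sum_(i < n) (n - 1) * (2 * 'C(m i, 2) + m i) =
    \sum_(i < n) \sum_(j < n | (i < j)%N) (m i * m i + m j * m j))%N.
  under [RHS]eq_bigr do rewrite big_split.
  rewrite /= big_split /= [X in (_ + X)%N](exchange_big_dep predT) //= -big_split /=.
  apply: eq_bigr => i _; rewrite bin2_double.
  have <- : (\sum_(j < n | j != i) m i * m i = (n - 1) * (m i * m i))%N.
    rewrite sum_nat_const; congr (_ * _)%N.
    by rewrite (eq_card (B := predC1 i)) // cardC1 card_ord subn1.
  rewrite (bigID (fun j : 'I_n => (i < j)%N)) /=; congr (_ + _)%N.
    by apply: eq_bigl => j; rewrite -(inj_eq val_inj) /=; case: ltngtP.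
  by apply: eq_bigl => j; rewrite -(inj_eq val_inj) /=; case: ltngtP.
rewrite /me2 big_distrr /=; apply: leq_sum => i _; rewrite big_distrr /=.
by apply: leq_sum => j _; rewrite !mulnn nat_Cauchy.
Qed.

Section WeightBound.
Variables (R : realType) (q : R) (n : nat) (x : 'I_n -> R[i]).
Hypotheses (q0 : 0 < q) (q1 : q < 1).
Local Notation Q := ((q%:C)%C : R[i]).
Hypothesis x0 : forall i, x i != 0.
Hypothesis xq : forall i j, i != j -> forall k : int, x i / x j != Q ^ k.

Let Q0 : Q != 0.
Proof. by rewrite fmorph_eq0 gt_eqF. Qed.

(** The reciprocal of the radius that the theorem allows for index [i]. *)
Definition growth i := normc (x i) ^+ n / normc (\prod_j x j) / Num.sqrt q ^+ (n - 1).

Lemma normc_pair_weight_le m a b : normc (pair_weight Q x m a b) <=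
  (normc (x b) + normc (x a)) / normc (x b - x a) / q ^+ (m a * m b).
Proof.
rewrite /pair_weight !Normc.normcM !Normc.normcV normcX normc_real ger0_norm ?(ltW q0) //.
rewrite ler_wpM2r ?invr_ge0 ?exprn_ge0 ?(ltW q0) // ler_wpM2r ?invr_ge0 ?normc_ge0 //.
apply: (le_trans (normcD _ _)); rewrite normcN /xshift !Normc.normcM !normcX normc_real.
rewrite ger0_norm ?(ltW q0) //.
by apply: lerD; rewrite ler_piMr ?normc_ge0 // exprn_ile1 // ltW.
Qed.

(** The bound is uniform in [k]: [q x_a / x_j] is never a power [q^(-k)], so each denominator stays
    away from 0. *)
Lemma normc_index_weight_le a : exists2 I : R, 0 <= I & forall k,
  normc (index_weight Q x a k) <=
  (normc (x a) ^+ n / normc (\prod_j x j)) ^+ k * (q ^+ (n - 1)) ^+ 'C(k, 2) * I.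
Proof.
have H j : exists c, 0 < c /\ forall k, c <= normc (qpoch Q (Q * (x a / x j)) k).
  have [|c c0 Hc] := @normc_qpoch_ge R q q0 q1 (Q * (x a / x j)); last by exists c.
  move=> k; have [->|aj] := eqVneq a j.
    by rewrite divff // mulr1; exact: qexp_neq.
  apply/eqP => E; have /negP := xq aj (- (k.+1%:Z)); apply; apply/eqP.
  by apply: (mulfI Q0); rewrite E -invr_expz -exprnP exprS invfM mulrA divff // mul1r.
have [c Hc] := choice H.
exists (\prod_j (c j)^-1) => [|k].
  by apply: prodr_ge0 => j _; rewrite invr_ge0 ltW //; case: (Hc j).
rewrite /index_weight !Normc.normcM Normc.normcV !normcX.
have -> : normc ((-1) ^+ (n - 1) * x a ^+ n / \prod_i x i) =
    normc (x a) ^+ n / normc (\prod_j x j).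
  by rewrite !Normc.normcM Normc.normcV !normcX normcN Normc.normc1 expr1n mul1r.
rewrite normc_real ger0_norm ?(ltW q0) //.
rewrite ler_wpM2l //.
  rewrite mulr_ge0 ?exprn_ge0 ?divr_ge0 ?exprn_ge0 ?normc_ge0 //; exact: ltW.
rewrite normc_prod -prodfV; apply: ler_prod => j _.
have [c0 Hk] := Hc j; rewrite invr_ge0 normc_ge0 lef_pV2 ?posrE ?Hk //.
exact: lt_le_trans (Hk k).
Qed.

Lemma normc_milne_weight_le : exists2 C : R, 0 <= C & forall m,
  normc (milne_weight Q x m) <= C * \prod_i growth i ^+ m i.
Proof.
have H a : exists I, 0 <= I /\ forall k,
  normc (index_weight Q x a k) <=
  (normc (x a) ^+ n / normc (\prod_j x j)) ^+ k * (q ^+ (n - 1)) ^+ 'C(k, 2) * I.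
  by have [I I0 HI] := normc_index_weight_le a; exists I.
have [I HI] := choice H.
pose P a b := (normc (x b) + normc (x a)) / normc (x b - x a).
have P0 a b : 0 <= P a b by rewrite divr_ge0 ?addr_ge0 ?normc_ge0.
pose PP := \prod_(a < n) \prod_(b < n | (a < b)%N) P a b.
have PP0 : 0 <= PP by apply: prodr_ge0 => a _; apply: prodr_ge0.
have I0 : 0 <= \prod_a I a by apply: prodr_ge0 => a _; case: (HI a).
exists (PP * \prod_a I a) => [|m]; first exact: mulr_ge0.
pose X a := normc (x a) ^+ n / normc (\prod_j x j).
have X0 a : 0 <= X a by rewrite divr_ge0 ?exprn_ge0 ?normc_ge0.
apply: (@le_trans _ _ ((PP / q ^+ me2 m) *
    (\prod_a X a ^+ m a * (q ^+ (n - 1)) ^+ (\sum_(a < n) 'C(m a, 2)) * \prod_a I a))).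
  rewrite /milne_weight Normc.normcM; apply: ler_pM; rewrite ?normc_ge0 //.
    rewrite normc_prod /PP /me2 -prodrXr -prodf_div; apply: ler_prod => a _.
    rewrite normc_ge0 normc_prod -prodrXr -prodf_div; apply: ler_prod => b _.
    by rewrite normc_ge0 normc_pair_weight_le.
  rewrite normc_prod -prodrXr -!big_split /=; apply: ler_prod => a _.
  by rewrite normc_ge0; case: (HI a) => _ /(_ (m a)).
have -> : \prod_i growth i ^+ m i =
    \prod_a X a ^+ m a / (Num.sqrt q ^+ (n - 1)) ^+ (\sum_(a < n) m a).
  by rewrite -prodrXr -prodf_div; apply: eq_bigr => a _; rewrite expr_div_n.
set Y := \prod_a X a ^+ m a; have Y0 : 0 <= Y by apply: prodr_ge0 => a _; rewrite exprn_ge0.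
set E := (q ^+ (n - 1)) ^+ _; set S := (Num.sqrt q ^+ _) ^+ _.
(* Written in powers of [Num.sqrt q], this is [me2_le]. *)
suff ES : E / q ^+ me2 m <= S^-1.
  have -> : PP / q ^+ me2 m * (Y * E * \prod_a I a) =
    (PP * \prod_a I a) * (Y * (E / q ^+ me2 m)) by ring.
  by rewrite ler_wpM2l ?mulr_ge0 // ler_wpM2l.
have s0 : 0 < Num.sqrt q by rewrite sqrtr_gt0.
have s1 : Num.sqrt q <= 1 by rewrite -sqrtr1 ler_wsqrtr // ltW.
have qE : q = Num.sqrt q ^+ 2 by rewrite sqr_sqrtr // ltW.
rewrite ler_pdivrMr ?exprn_gt0 // -[leRHS]mulrC ler_pdivlMr ?exprn_gt0 //.
rewrite /E /S {1 3}qE -!exprM -exprD.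
apply: ler_wiXn2l => //.
by have := me2_le m; lia.
Qed.
End WeightBound.

(** * Box sums *)

Section BoxSums.
Variables (R : realType) (n : nat) (t : ('I_n -> nat) -> R[i]) (C s : R).
Hypotheses (C0 : 0 <= C) (s0 : 0 < s) (s1 : s < 1).
Hypothesis tC : forall m, normc (t m) <= C * s ^+ mabs m.

(** The sum over the box factors into [n] truncated geometric series, so the bound does not depend
    on [K]. *)
Lemma box_geometric_le (h : R) K : 0 < h < 1 ->
  \sum_(f : {ffun 'I_n -> 'I_K}) h ^+ mabs (fun i => val (f i)) <= (1 - h)^-1 ^+ n.
Proof.
move=> /andP[h0 h1].
under eq_bigr do rewrite /mabs -prodrXr.
rewrite -(bigA_distr_bigA (fun (i : 'I_n) (k : 'I_K) => h ^+ k)) /=.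
rewrite prodr_const card_ord; apply: lerXn2r; rewrite ?nnegrE.
- by apply: sumr_ge0 => k _; rewrite exprn_ge0 // ltW.
- by rewrite invr_ge0 subr_ge0 ltW.
- exact: geometric_sum_le.
Qed.

Lemma box_sum_nondecreasing (g : ('I_n -> nat) -> R) : (forall m, 0 <= g m) ->
  nondecreasing_seq (fun K => \sum_(f : {ffun 'I_n -> 'I_K}) g (fun i => val (f i))).
Proof.
move=> g0; apply/nondecreasing_seqP => K.
pose e (f : {ffun 'I_n -> 'I_K}) : {ffun 'I_n -> 'I_K.+1} := [ffun i => widen_ord (leqnSn K) (f i)].
have eI : injective e.
  move=> f f' /ffunP E; apply/ffunP => i; have := E i; rewrite !ffunE => /(congr1 val) /= H.
  exact: val_inj.
have -> : \sum_(f : {ffun 'I_n -> 'I_K}) g (fun i => val (f i)) =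
    \sum_(f in e @: predT) g (fun i => val (f i)).
  rewrite big_imset /=; last by move=> f f' _ _; exact: eI.
  apply: eq_big => [f|f _]; first by [].
  congr g; apply/funext => i.
  by rewrite /e ffunE.
by rewrite [leRHS](bigID (mem (e @: predT))) /= lerDl sumr_ge0.
Qed.

Lemma box_sum_norm_cvg :
  cvgn (fun K => \sum_(f : {ffun 'I_n -> 'I_K}) `|t (fun i => val (f i))|).
Proof.
pose u K := \sum_(f : {ffun 'I_n -> 'I_K}) normc (t (fun i => val (f i))).
have uc : cvgn u.
  apply: nondecreasing_is_cvgn.
    by apply: (@box_sum_nondecreasing (fun m => normc (t m))) => m; exact: normc_ge0.
  exists (C * (1 - s)^-1 ^+ n) => _ [K _ <-].
  apply: (@le_trans _ _ (\sum_(f : {ffun 'I_n -> 'I_K}) C * s ^+ mabs (fun i => val (f i)))).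
    by apply: ler_sum => f _; exact: tC.
  by rewrite -mulr_sumr ler_wpM2l // box_geometric_le // s0.
apply/cvg_ex; exists ((limn u)%:C)%C; apply/(proj1 (@cvg_normcP R _ _)).
have -> : (fun K => normc (\sum_(f : {ffun 'I_n -> 'I_K}) `|t (fun i => val (f i))| - ((limn u)%:C)%C))
   = (fun K => `|limn u - u K|).
  apply/funext => K.
  have -> : \sum_(f : {ffun 'I_n -> 'I_K}) `|t (fun i => val (f i))| = ((u K)%:C)%C.
    by rewrite rmorph_sum.
  by rewrite -rmorphB normc_real distrC.
move/cvgrPdist_lt : uc => uc; apply/cvgrPdist_lt => e e0.
by apply: filterS (uc e e0) => K; rewrite sub0r normrN normr_id.
Qed.

(* The simplex |m| < K lies in the box, and on the rest of the box
   s^|m| <= h^K h^|m| with h = sqrt s. *)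
Lemma box_simplex_error : exists D h : R, 0 <= h < 1 /\ forall K,
  normc (\sum_(f : {ffun 'I_n -> 'I_K}) t (fun i => val (f i)) -
    \sum_(N < K) \sum_(f : {ffun 'I_n -> 'I_K} | mabs (fun i => val (f i)) == N)
      t (fun i => val (f i))) <= D * h ^+ K.
Proof.
pose h := Num.sqrt s.
have h0 : 0 < h by rewrite sqrtr_gt0.
have h1 : h < 1 by rewrite -sqrtr1 ltr_sqrt.
have sE : s = h ^+ 2 by rewrite sqr_sqrtr // ltW.
exists (C * (1 - h)^-1 ^+ n), h; split=> [|K]; first by rewrite h1 ltW.
rewrite (exchange_big_dep predT) //=.
rewrite -sumrB.
apply: (le_trans (normc_sum _ _ _)).
apply: (@le_trans _ _ (\sum_(f : {ffun 'I_n -> 'I_K}) C * h ^+ K * h ^+ mabs (fun i => val (f i)))).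
  apply: ler_sum => f _; set N := mabs _.
  have [NK|KN] := ltnP N K.
    rewrite (big_pred1 (Ordinal NK)) => [|k /=]; last by rewrite -val_eqE /= eq_sym.
    by rewrite subrr Normc.normc0 !mulr_ge0 ?exprn_ge0 // ltW.
  rewrite big_pred0 => [|k /=]; last by apply/negbTE; rewrite neq_ltn (leq_trans (ltn_ord k)) ?orbT.
  rewrite subr0; apply: le_trans (tC _) _; rewrite -/N -mulrA ler_wpM2l //.
  rewrite sE -exprM mul2n -addnn exprD ler_wpM2r ?exprn_ge0 ?(ltW h0) //.
  by apply: ler_wiXn2l => //; exact: ltW.
rewrite -mulr_sumr -mulrA [X in _ <= X]mulrAC -[X in _ <= X]mulrA ler_wpM2l //.
by rewrite ler_wpM2l ?exprn_ge0 ?(ltW h0) // box_geometric_le // h0.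
Qed.
End BoxSums.

(** Reorders the triangle [k + j < K] from antidiagonals to rows, so that for each [k] the inner sum
    over [j] can be a truncated q-binomial series. *)
Lemma sum_antidiagonals (V : nmodType) (g : nat -> nat -> V) K :
  \sum_(N < K) \sum_(k < N.+1) g k (N - k)%N = \sum_(k < K) \sum_(j < K - k) g k j.
Proof.
elim: K => [|K IH]; first by rewrite !big_ord0.
rewrite big_ord_recr /= IH !big_ord_recr /= subnn subSnn big_ord1 addrA; congr (_ + _).
rewrite -big_split /=; apply: eq_bigr => k _.
by rewrite subSn ?(ltnW (ltn_ord k)) // big_ord_recr.
Qed.

(** * Uniform bounds on the coefficients *)

Section Coefficients.
Variables (R : realType) (q : R).
Hypotheses (q0 : 0 < q) (q1 : q < 1).
Local Notation Q := ((q%:C)%C : R[i]).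

Lemma normc_qpoch_bound (a : R[i]) : exists2 A : R, 0 <= A & forall k, normc (qpoch Q a k) <= A.
Proof.
exists (expR (normc a / (1 - q))); first exact: expR_ge0.
by move=> k; exact: normc_qpoch_le.
Qed.

Lemma normc_qpochV_bound (a : R[i]) : (forall k, a != Q ^- k) ->
  exists2 A : R, 0 <= A & forall k, normc (qpoch Q a k)^-1 <= A.
Proof.
move=> /(normc_qpoch_ge q0 q1)[c c0 H]; exists c^-1; first by rewrite invr_ge0 ltW.
by move=> k; rewrite Normc.normcV lef_pV2 ?posrE // (lt_le_trans c0).
Qed.

Lemma normc_mul_bound (f g : nat -> R[i]) :
  (exists2 A : R, 0 <= A & forall k, normc (f k) <= A) ->
  (exists2 A : R, 0 <= A & forall k, normc (g k) <= A) ->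
  exists2 A : R, 0 <= A & forall k, normc (f k * g k) <= A.
Proof.
move=> [A A0 HA] [B B0 HB]; exists (A * B); first exact: mulr_ge0.
by move=> k; rewrite Normc.normcM ler_pM ?normc_ge0.
Qed.

(** Each of the [N.+1] terms is a bounded coefficient times [z^(N-k) w^k], of modulus at most
    [h ^+ N]. *)
Lemma normc_qphi_le (r s t u v z w : R[i]) (h : R) :
  (forall k, u != Q ^- k) -> (forall k, v != Q ^- k) -> normc z <= h -> normc w <= h ->
  exists2 A : R, 0 <= A &
    forall N, normc (qphi Q r s t u v z w N) <= A * (N.+1%:R * h ^+ N).
Proof.
move=> hu hv zh wh; have h0 : 0 <= h := le_trans (normc_ge0 _) zh.
have [A A0 HA] : exists2 A : R, 0 <= A & forall k,
    normc ((qpoch Q r k * qpoch Q s k * qpoch Q t k) * ((qpoch Q u k)^-1 * (qpoch Q v k)^-1)) <= A.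
  by do !apply: normc_mul_bound; (exact: normc_qpoch_bound || exact: normc_qpochV_bound).
have [B B0 HB] := normc_qpoch_bound Q.
have [D D0 HD] := normc_qpochV_bound (qexp_neq q0 q1).
exists (B * (D * D) * A) => [|N]; first by rewrite !mulr_ge0.
apply: (le_trans (normc_sum _ _ _)).
apply: (@le_trans _ _ (\sum_(k < N.+1) B * (D * D) * A * h ^+ N)); last first.
  by rewrite sumr_const card_ord -mulrnAr mulr_natl.
apply: ler_sum => k _; rewrite -mulrA Normc.normcM.
have kN : (k <= N)%N by rewrite -ltnS.
apply: ler_pM; rewrite ?normc_ge0 //.
  rewrite Normc.normcM ler_pM ?normc_ge0 //.
    rewrite /qbinom invfM !Normc.normcM.
    rewrite ler_pM ?mulr_ge0 ?normc_ge0 // ler_pM ?normc_ge0 //.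
  by have := HA k; rewrite invfM.
rewrite Normc.normcM !normcX.
have -> : h ^+ N = h ^+ (N - k) * h ^+ k by rewrite -exprD subnK.
by rewrite ler_pM ?exprn_ge0 ?normc_ge0 // lerXn2r ?nnegrE ?normc_ge0.
Qed.

End Coefficients.

(** * Summation of the multiple series by layers and then along [z] *)

Theorem theorem8 (R : realType) (q : R) (hq0 : 0 < q) (hq1 : q < 1)
  (n : nat) (hn : (0 < n)%N) (x : 'I_n -> R[i])
  (hx0 : forall i, x i != 0)
  (hxq : forall i j, i != j -> forall k : int, x i / x j != (q%:C)%C ^ k)
  (b z w r s t u v : R[i])
  (hu : forall m : nat, u != (q%:C)%C ^- m)
  (hv : forall m : nat, v != (q%:C)%C ^- m)
  (hbz : forall m : nat, b * z != (q%:C)%C ^- m)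
  (hz1 : `|z| < 1) (hw1 : `|w| < 1)
  (hzx : forall j, `|z| < `|\prod_(i < n) x i| * `|x j| ^- n * ((Num.sqrt q ^+ (n - 1))%:C)%C)
  (hwx : forall j, `|w| < `|\prod_(i < n) x i| * `|x j| ^- n * ((Num.sqrt q ^+ (n - 1))%:C)%C) :
  let term := fun m : 'I_n -> nat =>
    Wt (q%:C)%C x m * qpoch (q%:C)%C b (mabs m) * qphi (q%:C)%C r s t u v z w (mabs m) in
  let rhs_series := fun K : nat =>
    \sum_(N < K) (qpoch (q%:C)%C r N * qpoch (q%:C)%C s N * qpoch (q%:C)%C t N * qpoch (q%:C)%C b N)
                 / (qpoch (q%:C)%C (q%:C)%C N * qpoch (q%:C)%C u N * qpoch (q%:C)%C v N
                    * qpoch (q%:C)%C (b * z) N) * w ^+ N in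
  [/\ (* the multiple series over Z_{>=0}^n converges absolutely *)
      cvgn (fun K : nat => \sum_(f : {ffun 'I_n -> 'I_K}) `|term (fun i => val (f i))|),
      (* the series on the right converges *)
      cvgn rhs_series
    & (* and the sums agree (partial sums over the boxes [0,K)^n) *)
      (fun K : nat => \sum_(f : {ffun 'I_n -> 'I_K}) term (fun i => val (f i)))
        @ \oo --> qpoch_inf (q%:C)%C (b * z) / qpoch_inf (q%:C)%C z * limn rhs_series].
Proof.
move=> term rhs_series; set Q := (q%:C)%C.
have Q0 : Q != 0 by rewrite fmorph_eq0 gt_eqF.
have QX k : Q ^+ k.+1 != 1.
  apply/eqP => /(congr1 (@Normc.normc R)) /eqP; rewrite Normc.normc1 normcX normc_real.
  by rewrite ger0_norm ?(ltW hq0) // lt_eqF // exprn_ilt1 // ltW.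
have xx i j : i != j -> x i != x j.
  by move=> ij; apply/eqP => E; have /negP := hxq i j ij 0; apply; rewrite E divff // expr0z.
have WE m : Wt Q x m = milne_weight Q x m by exact: Wt_milne_weight.
have [C1 C10 HC1] := normc_milne_weight_le hq0 hq1 hx0 hxq.

pose rad j := normc (\prod_(i < n) x i) * (normc (x j) ^+ n)^-1 * Num.sqrt q ^+ (n - 1).
have radE j : `|\prod_(i < n) x i| * `|x j| ^- n * ((Num.sqrt q ^+ (n - 1))%:C)%C = ((rad j)%:C)%C.
  by rewrite /rad !norm_normc !rmorphM fmorphV !rmorphXn.
have prodx0 : 0 < normc (\prod_(i < n) x i) by apply: normc_gt0; apply/prodf_neq0.
have nx0 j : 0 < normc (x j) by exact: normc_gt0.
have sq0 : 0 < Num.sqrt q by rewrite sqrtr_gt0.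
have growthE j : growth q x j = (rad j)^-1.
  by rewrite /growth /rad; field; rewrite !expf_neq0 ?gt_eqF.
pose rho := Num.max (normc z) (normc w).
have zrho : normc z <= rho by rewrite le_max lexx.
have wrho : normc w <= rho by rewrite le_max lexx orbT.
have rho0 : 0 <= rho := le_trans (normc_ge0 _) zrho.
(* [s2] is the least allowed radius, capped at 1, and [sg] will be the midpoint of [rho] and [s2].
   The gap above [rho] absorbs the factor [N.+1] of [normc_qphi_le]; the gap below [s2] makes the
   ratio [th] less than 1. *)
pose s2 := \big[Num.min/1]_j rad j.
have rhos2 : rho < s2.
  rewrite lt_bigmin ?gt_max -?ltcR // -?norm_normc ?hz1 ?hw1 // => j _.
  by rewrite gt_max -!ltcR -!norm_normc -radE hzx hwx.
have s21 : s2 <= 1 by exact: bigmin_le_id.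
pose sg := (rho + s2) / 2.
have rhosg : rho < sg by rewrite /sg; lra.
have sgs2 : sg < s2 by rewrite /sg; lra.
have sg0 : 0 < sg := le_lt_trans rho0 rhosg.
have sg1 : sg < 1 := lt_le_trans sgs2 s21.
have sg01 : 0 <= sg < 1 by rewrite sg1 ltW.
have s20 : 0 < s2 := lt_trans sg0 sgs2.
pose th := sg / s2.
have th0 : 0 < th by rewrite divr_gt0.
have th1 : th < 1 by rewrite ltr_pdivrMr // mul1r.
have gth j : sg * growth q x j <= th.
  rewrite growthE ler_wpM2l ?(ltW sg0) // lef_pV2 ?posrE //; first exact: bigmin_le.
  by apply: lt_le_trans s20 _; exact: bigmin_le.
have natsg N : N.+1%:R * rho ^+ N <= sg / (sg - rho) * sg ^+ N.
  by apply: natSM_geometric; rewrite rho0.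
have sgrho0 : 0 <= sg / (sg - rho) by rewrite divr_ge0 ?subr_ge0 ?(ltW rhosg) ?(ltW sg0).
have [C2 C20 HC2] := normc_qpoch_bound hq0 hq1 b.
have [C3 C30 HC3] := normc_qphi_le hq0 hq1 r s t hu hv zrho wrho.
have [C C0 termC] : exists2 C : R, 0 <= C & forall m, normc (term m) <= C * th ^+ mabs m.
  have CC0 := mulr_ge0 (mulr_ge0 C10 C20) (mulr_ge0 C30 sgrho0).
  exists (C1 * C2 * (C3 * (sg / (sg - rho)))) => // m.
  have g0 j : 0 <= growth q x j.
    by rewrite growthE invr_ge0; apply: le_trans (ltW s20) _; exact: bigmin_le.
  apply: (@le_trans _ _ (C1 * \prod_i growth q x i ^+ m i * C2 *
      (C3 * (sg / (sg - rho) * sg ^+ mabs m)))).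
    rewrite /term -/Q WE Normc.normcM [normc (_ * qpoch _ _ _)]Normc.normcM ler_pM ?mulr_ge0 ?normc_ge0 //.
      by rewrite ler_pM ?normc_ge0.
    by apply: le_trans (HC3 _) _; rewrite ler_wpM2l.
  have -> : C1 * \prod_i growth q x i ^+ m i * C2 * (C3 * (sg / (sg - rho) * sg ^+ mabs m)) =
     C1 * C2 * (C3 * (sg / (sg - rho))) * \prod_i (sg * growth q x i) ^+ m i.
    under [in RHS]eq_bigr do rewrite exprMn.
    by rewrite big_split /= prodrXr -/(mabs m); ring.
  rewrite (ler_wpM2l CC0) // -prodrXr; apply: ler_prod => j _.
  have sgj : 0 <= sg * growth q x j by rewrite mulr_ge0 // ltW.
  by rewrite exprn_ge0 //= lerXn2r ?nnegrE // ltW.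
(* The coefficient of the right-hand series without [(bz;q)_k]; that factor comes from the
   q-binomial sum along [z]. *)
pose a k := qpoch Q r k * qpoch Q s k * qpoch Q t k * qpoch Q b k *
   ((qpoch Q Q k)^-1 * ((qpoch Q u k)^-1 * (qpoch Q v k)^-1)).
have [A A0 HA] : exists2 A : R, 0 <= A & forall k, normc (a k) <= A.
  by do !apply: normc_mul_bound;
    (exact: normc_qpoch_bound || (apply: normc_qpochV_bound => //; exact: qexp_neq)).
have [A' A'0 HA'] : exists2 A : R, 0 <= A & forall k, normc (a k * (qpoch Q (b * z) k)^-1) <= A.
  by apply: normc_mul_bound; [exists A|apply: normc_qpochV_bound].
have Qn0 k : qpoch Q Q k != 0 := qpoch_neq0 hq0 hq1 k (qexp_neq hq0 hq1).
have rhsE K : rhs_series K = \sum_(N < K) a N * (qpoch Q (b * z) N)^-1 * w ^+ N.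
  apply: eq_bigr => N _; congr (_ * _); rewrite /a -/Q !invfM; ring.
have w1 : normc w < 1 by rewrite -ltcR -norm_normc.
have z1 : normc z < 1 by rewrite -ltcR -norm_normc.
have w01 : 0 <= normc w < 1 by rewrite w1 normc_ge0.
have rhs_cvg : cvgn rhs_series.
  have [k|l Hl] := geometric_increments (u := rhs_series) w01 A'0.
    have -> : rhs_series k.+1 - rhs_series k = a k * (qpoch Q (b * z) k)^-1 * w ^+ k.
      by rewrite !rhsE big_ord_recr /=; ring.
    by rewrite Normc.normcM normcX ler_wpM2r ?exprn_ge0 ?normc_ge0 //; exact: HA'.
  by apply/cvg_ex; exists l; apply: (geometric_error_cvg w01 Hl); exact: cvg_cst.
split; [exact: box_sum_norm_cvg C0 th0 th1 termC|exact: rhs_cvg|].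
have [D [h [h01 HD]]] := box_simplex_error C0 th0 th1 termC.
apply: (geometric_error_cvg h01 HD).
pose c k j := qpoch Q (b * Q ^+ k) j / qpoch Q Q j * z ^+ j.
(* Here [(b;q)_N] splits as [(b;q)_k] times [(b q^k;q)_(N-k)], and the layer sum [1 / (q;q)_N]
   cancels the numerator of the q-binomial coefficient; this leaves a convolution in [k] and
   [N - k]. *)
have layer K N : (N < K)%N ->
    \sum_(f : {ffun 'I_n -> 'I_K} | mabs (fun i => val (f i)) == N) term (fun i => val (f i)) =
    \sum_(k < N.+1) a k * w ^+ k * c k (N - k)%N.
  move=> NK.
  rewrite (eq_bigr (fun f : {ffun 'I_n -> 'I_K} => milne_weight Q x (fun i => val (f i)) *
      (qpoch Q b N * qphi Q r s t u v z w N))); last first.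
    by move=> f /eqP fN; rewrite /term -/Q fN -mulrA WE.
  rewrite -big_distrl /= (milne_sum Q0 QX hx0 hxq hn NK) -/(qpoch Q Q N).
  rewrite /qphi !big_distrr /=; apply: eq_bigr => k _.
  have kN : (k <= N)%N by rewrite -ltnS.
  have bN : qpoch Q b N = qpoch Q b k * qpoch Q (b * Q ^+ k) (N - k).
    by rewrite -qpochD subnKC.
  rewrite /qbinom /a /c bN.
  have Hu := qpoch_neq0 hq0 hq1 k hu; have Hv := qpoch_neq0 hq0 hq1 k hv.
  by field; rewrite !Qn0 Hu Hv.
have simplex K : \sum_(N < K) \sum_(f : {ffun 'I_n -> 'I_K} | mabs (fun i => val (f i)) == N)
      term (fun i => val (f i)) = \sum_(k < K) a k * w ^+ k * \sum_(j < K - k) c k j.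
  under eq_bigr => N _ do rewrite (layer _ _ (ltn_ord N)).
  rewrite (sum_antidiagonals (fun k j => a k * w ^+ k * c k j)).
  by apply: eq_bigr => k _; rewrite big_distrr.
have rho01 : 0 <= rho < 1 by rewrite rho0 (lt_trans rhosg).
have [E E0 HE] := q_binomial hq0 hq1 (normc b) rho01.
pose P := qpoch_inf Q (b * z) / qpoch_inf Q z.
(* Splitting the infinite product in [bz] after [k] factors turns [P / (bz;q)_k] into the q-binomial
   value with parameter [b q^k]. *)
have rhsF K : P * rhs_series K = \sum_(k < K) a k * w ^+ k *
    (qpoch_inf Q (b * Q ^+ k * z) / qpoch_inf Q z).
  rewrite rhsE big_distrr /=; apply: eq_bigr => k _.
  rewrite /P (qpoch_infD hq0 hq1 (b * z) k).
  rewrite [b * Q ^+ k * z]mulrAC; have Hbz := qpoch_neq0 hq0 hq1 k hbz.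
  have Hz : qpoch_inf Q z != 0 by apply: qpoch_inf_neq0 => //; exact: lt1_neq_qexp.
  by field; rewrite Hz Hbz.
have PL : (fun K => P * rhs_series K) @ \oo --> P * limn rhs_series.
  by apply: cvgM; [exact: cvg_cst|exact: rhs_cvg].
apply: (geometric_error_cvg (C := A * E * (sg / (sg - rho))) sg01 _ PL) => K.
rewrite simplex rhsF -sumrB.
apply: (le_trans (normc_sum _ _ _)).
(* Row [k] is cut at [K - k], with error [E rho^(K-k)]; together with [rho^k] from [w ^+ k] every
   row costs the same [rho ^+ K], and the number [K] of rows is absorbed by [natsg]. *)
apply: (@le_trans _ _ (\sum_(k < K) A * E * rho ^+ K)).
  apply: ler_sum => k _; have kK := ltnW (ltn_ord k).
  rewrite -mulrBr Normc.normcM [normc (a k * _)]Normc.normcM normcX.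
  have -> : A * E * rho ^+ K = A * rho ^+ k * (E * rho ^+ (K - k)).
    by rewrite mulrACA -exprD subnKC.
  rewrite ler_pM ?mulr_ge0 ?exprn_ge0 ?normc_ge0 //.
    rewrite ler_pM ?exprn_ge0 ?normc_ge0 //.
    by rewrite lerXn2r ?nnegrE ?normc_ge0.
  apply: HE => //; rewrite Normc.normcM normcX normc_real ger0_norm ?(ltW hq0) //.
  by rewrite ler_piMr ?normc_ge0 // exprn_ile1 // ltW.
rewrite sumr_const card_ord -mulrnAr -[X in _ <= X]mulrA ler_wpM2l ?mulr_ge0 //.
apply: le_trans (natsg K); rewrite -mulr_natl ler_wpM2r ?exprn_ge0 //.
by rewrite ler_nat.
Qed.
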